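(* Let $Q = (f^k, f \alpha)$ be an $\mathfrak{F}$-basic ideal of $O$ different from $fO$, where $f^k=N(Q)$ and $\alpha\in D\setminus O$. Then $Q$ is a $D$-module if and only if $f^{k - 1}$ divides $N(\alpha)$.
   Context: Let $d$ be a square-free integer ($d\neq 1$), $K=\mathbb{Q}(\sqrt d)$ and $D=\mathbb{Z}[\omega]$ its ring of integers, where $\omega=\sqrt d$ if $d\equiv 2,3 \pmod 4$ and $\omega=(1+\sqrt d)/2$ if $d\equiv 1\pmod 4$. Let $f$ be a prime number and $O=\mathbb{Z}[f\omega]$, the unique order of $K$ with $[D:O]=f$. The conductor of $O$ is $\mathfrak{F}=\{x\in O: xD\subseteq O\}=fD$; it is a prime ideal of $O$. An ideal of $O$ is $\mathfrak{F}$-primary if it is primary with radical $\mathfrak{F}$; an $\mathfrak{F}$-primary ideal is $\mathfrak{F}$-basic if it is not contained in $\mathfrak{F}^2$. For $\alpha,\beta\in O$, $(\alpha,\beta)=\alpha O+\beta O$. $N(Q)=|O/Q|$ is the norm of an ideal $Q$ of $O$, and $N(\alpha)$ is the norm of the element $\alpha$ from $K$ to $\mathbb{Q}$. An ideal $Q$ of $O$ is a $D$-module if $QD=Q$. (Every $\mathfrak{F}$-basic ideal different from $fO$ can be written in the form $(f^k,f\alpha)$ with $f^k=N(Q)$ and $\alpha\in D\setminus O$.) *)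

(* Defs.v *)
From mathcomp Require Import all_boot all_order all_algebra all_field.
From mathcomp Require Import classical_sets cardinality.

Set Implicit Arguments.
Unset Strict Implicit.
Unset Printing Implicit Defensive.

Import GRing.Theory.
Local Open Scope classical_set_scope.
Local Open Scope ring_scope.

Definition squarefreez (d : int) : Prop :=
  forall m : int, (m ^+ 2 %| d)%Z -> `|m|%N = 1%N.

(** Rings and ideals are subsets of an ambient commutative field [K], so that
    the product [QD] of an ideal of [O] with a larger ring [D] makes sense. *)
Section Ideals.
Variable K : fieldType.
Implicit Types (O D Q I J : set K) (a b x y : K).

Definition Zadjoin x : set K :=
  [set y | exists p : {poly int}, y = (map_poly intr p).[x]].

Definition is_ideal O Q : Prop :=
  [/\ Q `<=` O, Q 0,
      (forall x y, Q x -> Q y -> Q (x + y)) &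
      (forall r x, O r -> Q x -> Q (r * x))].

Definition ideal_prod I J : set K :=
  [set x | exists (n : nat) (u v : 'I_n -> K),
     [/\ (forall i, I (u i)), (forall i, J (v i)) &
         x = \sum_(i < n) u i * v i]].

Definition gen1 O a : set K := [set x | exists2 u, O u & x = a * u].
Definition gen2 O a b : set K :=
  [set x | exists u v, [/\ O u, O v & x = a * u + b * v]].

Definition radical O Q : set K :=
  [set x | O x /\ exists2 n : nat, (0 < n)%N & Q (x ^+ n)].

Definition is_primary O Q : Prop :=
  [/\ is_ideal O Q, Q <> O &
      forall x y, O x -> O y -> Q (x * y) -> Q x \/ radical O Q y].

(** [O / Q] as the set of cosets [x + Q], [x] in [O] *)
Definition quotient_set O Q : set (set K) :=
  [set C | exists2 x, O x & C = [set y | Q (y - x)]].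

(** [|O / Q| = n] *)
Definition has_norm O Q (n : nat) : Prop := (quotient_set O Q #= `I_n)%card.

Definition conductor O D : set K :=
  [set x | O x /\ forall y, D y -> O (x * y)].

Definition is_basic O D Q : Prop :=
  let F := conductor O D in
  [/\ is_primary O Q, radical O Q = F & ~ (Q `<=` ideal_prod F F)].

Definition is_module D Q : Prop := ideal_prod Q D = Q.

End Ideals.

(** [s] stands for [sqrt d]. *)
Definition omega (K : fieldType) (d : int) (s : K) : K :=
  if (d %% 4)%Z == 1 then (1 + s) / 2%:R else s.

Definition is_quadratic_field (d : int) (K : fieldExtType rat) (s : K) : Prop :=
  s ^+ 2 = d%:~R /\ <<1; s>>%VS = {:K}%VS.

Definition maximal_order (K : fieldType) (d : int) (s : K) : set K :=
  Zadjoin (omega d s).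

Definition order_of_index (K : fieldType) (d : int) (s : K) (f : nat) : set K :=
  Zadjoin (f%:R * omega d s).

(** The norm from [K] to [Q] is computed in [K]; the integer [m] divides it
    if it is the image of a multiple of [m] in [Z]. *)
Definition dvd_norm (K : splittingFieldType rat) (m : int) (a : K) : Prop :=
  exists2 z : int, (m %| z)%Z & galNorm 1%VS {:K}%VS a = z%:~R.

(* Main.v *)
Require Import Defs.
From mathcomp Require Import all_boot all_order all_algebra all_field.
From mathcomp Require Import classical_sets cardinality.
From mathcomp Require Import ring.

Import GRing.Theory.
Local Open Scope classical_set_scope.
Local Open Scope ring_scope.

(** Write [w] for the generator of [D], with [w ^+ 2 = t w - n], and
    [alpha = a + b w]; as [alpha] is not in [O], the prime [f] does not divide
    [b], so [b] is invertible modulo [f ^ k].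

    The heart of the proof is a description of [Q] by one congruence
    ([mem_lattice_congruence]): in the basis [1, f w] of [O], a pair [(x, y)]
    lies in [Q] iff [x b = y f a] modulo [f ^ k].  The pairs that satisfy the
    congruence form a lattice of index [f ^ k], generated by [f ^ k], [f alpha]
    and [f ^ k (f w)], hence contained in [Q].  The index of [Q] is also [f ^ k],
    which leaves no room for anything else; [norm_dvd_of_mem] expresses this
    as [Q] containing no integers but the multiples of its norm.

    Since [D = Z + Z w], [Q] is a [D]-module iff it is stable under
    multiplication by [w], which can be tested on the generators.  The
    element [f ^ k w] has coordinates [(0, f ^ (k - 1))] and always satisfies
    the congruence, because [k > 0].  For [f alpha w = (- f b n, a + b t)] the
    congruence says that [f ^ k] divides [f (a ^ 2 + a b t + b ^ 2 n)], and
    the second factor is the norm of [alpha] ([galNorm_quadratic]), because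
    the nontrivial automorphism of [K] sends [w] to [t - w]. *)

(** * The norm of a quadratic integer *)

(** In lowest terms [q ^+ 2 = d] makes the square of the numerator divide [d],
    so the numerator is a unit, and then the denominator is one too. *)
Lemma squarefree_rat_square (d : int) (q : rat) :
  squarefreez d -> q ^+ 2 = d%:~R -> d = 1.
Proof.
move=> d_sqfree q2d.
have num2 : numq q ^+ 2 = d * denq q ^+ 2.
  apply: (@intr_inj rat); rewrite !(rmorphM, rmorphXn) /= -q2d.
  by rewrite -exprMn numqE.
have co : coprimez (numq q ^+ 2) (denq q ^+ 2).
  by rewrite coprimezE !abszX coprimeXl // coprimeXr // coprime_num_den.
have num_unit : `|numq q|%N = 1%N.
  by apply: d_sqfree; rewrite -(Gauss_dvdzl _ co) -num2.
have sqr_unit (z : int) : `|z|%N = 1%N -> z ^+ 2 = 1.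
  by case: z => [[|[|?]]|[|?]].
rewrite (sqr_unit _ num_unit) in num2.
have /eqP := congr1 absz num2.
rewrite abszM abszX eq_sym -mulnn !muln_eq1 andbb => /andP[_ /eqP den_unit].
by rewrite num2 sqr_unit ?mulr1.
Qed.

(** The product rule [x ^+ 2 = t x - n] reduces every power of [x]. *)
Lemma Zadjoin_quadratic (K : fieldType) (x : K) (t n : int) :
  x ^+ 2 = t%:~R * x - n%:~R ->
  forall y, Zadjoin x y <-> exists a b : int, y = a%:~R + b%:~R * x.
Proof.
move=> x2 y; split=> [[p ->] | [a [b ->]]]; last first.
  exists (a%:P + b%:P * 'X).
  by rewrite rmorphD rmorphM /= !map_polyC map_polyX /= !hornerE.
elim/poly_ind: p => [|p c [a [b IHp]]].
  by exists 0, 0; rewrite rmorph0 horner0; ring.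
exists (c - b * n), (a + b * t).
rewrite rmorphD rmorphM /= map_polyX map_polyC /= hornerMXaddC IHp.
have -> : (a%:~R + b%:~R * x) * x + c%:~R
          = a%:~R * x + b%:~R * x ^+ 2 + c%:~R by ring.
by rewrite x2; ring.
Qed.

Lemma pchar0_ratExt (K : fieldExtType rat) : [pchar K] =i pred0.
Proof. by move=> p; rewrite pchar_lalg Num.Theory.pchar_num. Qed.

Lemma intr_inj_ratExt (K : fieldExtType rat) : injective (fun z : int => z%:~R : K).
Proof.
move=> y z /=; rewrite -!(rmorph_int (in_alg K)) => /fmorph_inj.
exact: intr_inj.
Qed.

Lemma galois_ratExt (K : splittingFieldType rat) : galois 1%VS {:K}%VS.
Proof.
rewrite /galois sub1v normalFieldf andbT /=.
by apply/separableP => y _; apply/pcharf0_separable/pchar0_ratExt.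
Qed.

(** An automorphism maps [w] to a root of its polynomial, [w] or [t - w].  Some
    automorphism must move [w], as only rational elements are fixed by the
    whole group; so the Galois group is the identity and [w |-> t - w]. *)
Lemma galNorm_quadratic (K : splittingFieldType rat) (w : K) (t n : int) :
    w ^+ 2 = t%:~R * w - n%:~R -> <<1; w>>%VS = {:K}%VS -> w \notin 1%VS ->
  forall a b : int, galNorm 1%VS {:K}%VS (a%:~R + b%:~R * w)
    = (a ^+ 2 + a * b * t + b ^+ 2 * n)%:~R.
Proof.
move=> w2 Kw wQ a b.
have gal_w g : g \in 'Gal(<<1; w>> / 1)%g -> g w = w \/ g w = t%:~R - w.
  move=> _; have : g w ^+ 2 = t%:~R * g w - n%:~R.
    by rewrite -rmorphXn w2 rmorphB rmorphM /= !rmorph_int.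
  (* the factorization of the polynomial of [w], evaluated at [g w] *)
  move=> gw2; have /eqP : (g w - w) * (g w - (t%:~R - w)) = 0.
    have -> : (g w - w) * (g w - (t%:~R - w))
      = g w ^+ 2 - t%:~R * g w + t%:~R * w - w ^+ 2 by ring.
    by rewrite gw2 w2; ring.
  rewrite mulf_eq0 !subr_eq0 => /orP[] /eqP ->; [by left | by right].
have [g gG gw] : exists2 g, g \in 'Gal(<<1; w>> / 1)%g & g w <> w.
  have := galois_ratExt K; rewrite -Kw => /galois_fixedField fixK.
  have [/exists_inP[g gG /eqP gw]|] :=
    boolP [exists g in 'Gal(<<1; w>> / 1)%g, g w != w]; first by exists g.
  rewrite negb_exists_in => /forall_inP fixw; case/negP: wQ.
  rewrite -fixK; apply/fixedFieldP; first exact: memv_adjoin.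
  by move=> g /fixw /negPn /eqP.
have gE : g w = t%:~R - w by case: (gal_w g gG).
have GE : 'Gal(<<1; w>> / 1)%g = [set (1%g : gal_of <<1; w>>%AS); g]%SET.
  apply/setP => h; rewrite !inE; apply/idP/idP => [hG|]; last first.
    by case/orP => /eqP ->.
  rewrite !gal_adjoin_eq ?gal_id // gE.
  by case: (gal_w h hG) => ->; rewrite eqxx ?orbT.
have g_neq1 : (1%g : gal_of <<1; w>>%AS) \notin [set g]%SET.
  by rewrite inE; apply/eqP => g1; apply: gw; rewrite -g1 gal_id.
rewrite -Kw /galNorm GE (big_setU1 _ g_neq1) big_set1 /= gal_id.
rewrite rmorphD rmorphM /= !rmorph_int gE.
have -> : (a%:~R + b%:~R * w) * (a%:~R + b%:~R * (t%:~R - w))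
  = a%:~R ^+ 2 + a%:~R * b%:~R * t%:~R + b%:~R ^+ 2 * (t%:~R * w - w ^+ 2) by ring.
by rewrite w2; ring.
Qed.

(** If [d = 4 m + 1], the polynomial of [(1 + s) / 2] is [X ^ 2 - X - m]; otherwise
    it is [X ^ 2 - d]. *)
Lemma omega_quadratic (K : fieldType) (d : int) (s : K) :
    (2%:R : K) != 0 -> s ^+ 2 = d%:~R ->
  exists t n : int, omega d s ^+ 2 = t%:~R * omega d s - n%:~R.
Proof.
move=> two s2; rewrite /omega; case: ifP => [/eqP d1 | _]; last first.
  by exists 0, (- d); rewrite s2; ring.
have dE : d = (d %/ 4)%Z * 4 + 1 by rewrite {1}(divz_eq d 4) d1.
exists 1, (- (d %/ 4)%Z).
have s2' : s ^+ 2 = (d %/ 4)%Z%:~R * 4 + 1 by rewrite s2 {1}dE rmorphD rmorphM.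
have -> : ((1 + s) / 2) ^+ 2 = (1 + 2 * s + s ^+ 2) / 4.
  by field; rewrite (natrM _ 2 2) mulf_neq0.
rewrite s2'; field.
by rewrite two (natrM _ 2 2) mulf_neq0.
Qed.

(** [s] is a rational combination of [1] and [omega], so these properties
    of [omega] follow from those of [s]. *)
Lemma omega_generator (d : int) (K : fieldExtType rat) (s : K) :
    squarefreez d -> d <> 1 -> is_quadratic_field d s ->
  omega d s \notin 1%VS /\ <<1; omega d s>>%VS = {:K}%VS.
Proof.
move=> d_sqfree d_neq1 [s2 Ks].
have two : (2%:R : K) != 0.
  by have /pcharf0P -> := pchar0_ratExt K.
have sE (U : {subfield K}) : omega d s \in U -> s \in U.
  rewrite /omega; case: ifP => // _ Uw.
  have -> : s = (1 + s) / 2 * 2 - 1 by rewrite divfK // addrC addKr.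
  by rewrite rpredB ?rpred1 // rpredM // rpred_nat.
split.
  apply/negP => /(sE 1%AS) /vlineP[q sq]; apply: d_neq1.
  apply: (@squarefree_rat_square d q) => //; apply: (fmorph_inj (in_alg K)).
  by rewrite rmorphXn rmorph_int /= -sq.
apply/eqP; rewrite eqEsubv subvf /= -Ks.
apply/FadjoinP; split; first exact: sub1v.
by apply: (sE <<1; omega d s>>%AS); apply: memv_adjoin.
Qed.

(** * Ideals of given norm in a quadratic order *)

(** Every class modulo [Q] contains an integer, so a nonzero integer [r] in [Q]
    leaves at most [|r|] classes.  Applied to the remainder [r] of [z] modulo
    [N], this contradicts the count of [N] classes unless [r = 0]. *)
Lemma norm_dvd_of_mem (K : fieldType) (O Q : set K) (N : nat) :
    (forall z : int, O z%:~R) -> is_ideal O Q -> has_norm O Q N ->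
    Q N%:R -> (0 < N)%N -> (forall x, O x -> exists z : int, Q (x - z%:~R)) ->
  forall z : int, Q z%:~R -> (N %| z)%Z.
Proof.
move=> OZ [QO Q0 QD QM] NQ QN N_gt0 Oz z Qz.
have QZ (m : int) x : Q x -> Q (m%:~R * x) by apply: QM.
have QB x y : Q x -> Q y -> Q (x - y).
  by move=> Qx Qy; rewrite -mulN1r; apply: QD => //; apply: (QZ (-1)).
pose r := (z %% N)%Z.
have Nz : N%:Z != 0 by rewrite -lt0n.
have r_ge0 : 0 <= r by apply: modz_ge0.
have rN : r < N by apply: ltz_mod.
have Qr : Q r%:~R.
  rewrite /r /modz rmorphB rmorphM /=; apply: QB => //; exact: (QZ _ N%:R).
case: (r =P 0) => [r0|/eqP r_neq0]; first by apply/dvdz_mod0P.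
have : (`I_N #<= `I_`|r|)%card.
  apply: (card_le_trans (B := quotient_set O Q)).
    by move: NQ => /card_esym /card_eqPle [].
  apply: (card_le_trans _ (card_image_le (fun i : nat => [set y | Q (y - i%:R)]) _)).
  apply: subset_card_le => _ [x Ox ->].
  have [m Qxm] := Oz x Ox.
  have Qxi : Q (x - (`|(m %% r)%Z|%N)%:R).
    rewrite -[_%:R]/((`|(m %% r)%Z|%N : int)%:~R) gez0_abs ?modz_ge0 //.
    have -> : x - (m %% r)%Z%:~R = x - m%:~R + (m %/ r)%Z%:~R * r%:~R.
      by rewrite /modz; ring.
    by apply: QD => //; apply: QZ.
  exists `|(m %% r)%Z|%N.
    rewrite /= -ltz_nat gez0_abs ?modz_ge0 //; exact: ltz_mod.
  apply/seteqP; split => y /= Qy.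
    have -> : y - x = (y - (`|(m %% r)%Z|%N)%:R) - (x - (`|(m %% r)%Z|%N)%:R) by ring.
    exact: QB.
  have -> : y - (`|(m %% r)%Z|%N)%:R = (y - x) + (x - (`|(m %% r)%Z|%N)%:R) by ring.
  exact: QD.
rewrite card_le_II leqNgt => /negP[].
by rewrite -ltz_nat gez0_abs.
Qed.

Lemma dvdzNr (m n : int) : (m %| - n)%Z = (m %| n)%Z.
Proof. by rewrite !dvdzE abszN. Qed.

(** With [u b + v f ^ k = 1], the element [u f alpha + v f ^ k (f w)] of [Q] has
    coordinates [(u f a, 1)].  Subtracting [y] times it from [(x, y)] leaves an
    integer, which is in [Q] iff [f ^ k] divides it, the norm of [Q] being
    [f ^ k]. *)
Lemma mem_lattice_congruence (K : fieldType) (w : K) (f k : nat) (a b : int)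
    (O Q : set K) :
    prime f -> (forall x, O x <-> exists y z : int, x = y%:~R + z%:~R * (f%:R * w)) ->
    is_ideal O Q -> has_norm O Q (f ^ k)%N ->
    Q (f%:R ^+ k) -> Q (f%:R * (a%:~R + b%:~R * w)) -> ~~ (f%:Z %| b)%Z ->
  forall x y : int,
    Q (x%:~R + y%:~R * (f%:R * w)) <-> (f%:Z ^+ k %| x * b - y * f%:Z * a)%Z.
Proof.
move=> f_prime OE idQ NQ Qfk Qfa fb x y.
have [QO Q0 QD QM] := idQ.
have OZ (z : int) : O z%:~R by apply/OE; exists z, 0; ring.
have /coprimezP[[u v] /= uv] : coprimez b (f%:Z ^+ k).
  by rewrite coprimezE abszX coprimeXr // coprime_sym prime_coprime.
have uvK : u%:~R * b%:~R + v%:~R * f%:R ^+ k = 1 :> K.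
  by have := congr1 (fun z : int => z%:~R : K) uv; rewrite rmorphD !rmorphM rmorphXn.
have Q_lin (x' y' : int) :
  exists2 q, Q q & x'%:~R + y'%:~R * (f%:R * w)
                   = (x' - u * y' * f%:Z * a)%:~R + q.
  exists ((u * y')%:~R * (f%:R * (a%:~R + b%:~R * w))
          + ((v * y')%:~R * (f%:R * w)) * f%:R ^+ k).
    apply: (QD); apply: (QM) => //; apply/OE; exists 0, (v * y'); ring.
  have -> : y'%:~R * (f%:R * w)
    = y'%:~R * (f%:R * w) * (u%:~R * b%:~R + v%:~R * f%:R ^+ k) by rewrite uvK mulr1.
  ring.
have fkE : f%:Z ^+ k = (f ^ k)%N by rewrite -[in RHS]natz natrX natz.
have Q_sub p q : Q p -> Q (p + q) -> Q q.
  move=> Qp Qpq; rewrite -[q](addKr p); apply: QD => //.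
  by rewrite -mulN1r; apply: QM => //; apply: (OZ (-1)).
split=> [Qxy | /dvdzP[m xyE]].
  have [q Qq qE] := Q_lin x y.
  have : (f%:Z ^+ k %| x - u * y * f%:Z * a)%Z.
    rewrite fkE; apply: (norm_dvd_of_mem _ _ _ _ OZ idQ NQ).
    - by rewrite natrX.
    - by rewrite expn_gt0 prime_gt0.
    - move=> z /OE[z1 [z2 ->]]; have [q' Qq' ->] := Q_lin z1 z2.
      by exists (z1 - u * z2 * f%:Z * a); rewrite addrC addKr.
    by apply: (Q_sub q) => //; rewrite addrC -qE.
  case/dvdzP => m xE; apply/dvdzP; exists (m * b - v * y * f%:Z * a).
  have -> : x = m * f%:Z ^+ k + u * y * f%:Z * a by rewrite -xE; ring.
  have -> : y * f%:Z * a = y * f%:Z * a * (u * b + v * f%:Z ^+ k) by rewrite uv mulr1.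
  ring.
(* [m f ^ k = x b - y f a]; the combination comes from multiplying [(x, y)]
   by [u b + v f ^ k] and replacing [x b] by [y f a + m f ^ k]. *)
have -> : x%:~R + y%:~R * (f%:R * w) =
  (u * y)%:~R * (f%:R * (a%:~R + b%:~R * w))
  + ((u * m + v * x)%:~R + (v * y)%:~R * (f%:R * w)) * f%:R ^+ k.
  have mK : m%:~R * f%:R ^+ k = x%:~R * b%:~R - y%:~R * f%:R * a%:~R :> K.
    have := congr1 (fun z : int => z%:~R : K) xyE.
    by rewrite rmorphB !rmorphM rmorphXn => ->.
  transitivity ((x%:~R + y%:~R * (f%:R * w)) * (u%:~R * b%:~R + v%:~R * f%:R ^+ k)).
    by rewrite uvK mulr1.
  transitivity ((u * y)%:~R * (f%:R * (a%:~R + b%:~R * w)) + u%:~R * (m%:~R * f%:R ^+ k)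
     + (v * x)%:~R * f%:R ^+ k + (v * y)%:~R * (f%:R * w) * f%:R ^+ k); last by ring.
  by rewrite mK; ring.
apply: QD; apply: QM => //.
by apply/OE; exists (u * m + v * x), (v * y).
Qed.

Theorem proposition3p2 (d : int) (d_sqfree : squarefreez d) (d_neq1 : d <> 1)
    (K : splittingFieldType rat) (s : K) (Ks : is_quadratic_field d s)
    (f : nat) (f_prime : prime f)
    (D : set K) (defD : D = maximal_order d s)
    (O : set K) (defO : O = order_of_index d s f)
    (Q : set K) (Q_basic : is_basic O D Q) (Q_neq : Q <> gen1 O f%:R)
    (k : nat) (NQ : has_norm O Q (f ^ k)%N)
    (alpha : K) (alphaD : D alpha) (alphaO : ~ O alpha)
    (defQ : Q = gen2 O (f%:R ^+ k) (f%:R * alpha)) :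
  is_module D Q <-> dvd_norm (f%:Z ^+ k.-1) alpha.
Proof.
have two : (2%:R : K) != 0.
  by have /pcharf0P -> := pchar0_ratExt K.
have [t [n w2]] := omega_quadratic _ _ _ two Ks.1.
have [wQ Kw] := omega_generator _ _ _ d_sqfree d_neq1 Ks.
move: defD defO; rewrite /maximal_order /order_of_index.
move: (omega d s) w2 wQ Kw => w w2 wQ Kw defD defO.
have DE x : D x <-> exists y z : int, x = y%:~R + z%:~R * w.
  by rewrite defD; apply: (Zadjoin_quadratic _ _ t n).
have OE x : O x <-> exists y z : int, x = y%:~R + z%:~R * (f%:R * w).
  rewrite defO; apply: (Zadjoin_quadratic _ _ (f%:Z * t) (f%:Z ^+ 2 * n)).
  have -> : (f%:R * w) ^+ 2 = f%:R ^+ 2 * w ^+ 2 by ring.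
  by rewrite w2; ring.
have [[idQ Q_proper _] _ _] := Q_basic.
have [QO Q0 QD QM] := idQ.
have OZ (z : int) : O z%:~R by apply/OE; exists z, 0; ring.
have Qgen x y : O x -> O y -> Q (f%:R ^+ k * x + f%:R * alpha * y).
  by move=> Ox Oy; rewrite defQ; exists x, y.
have Qfk : Q (f%:R ^+ k).
  by rewrite -[X in Q X](_ : f%:R ^+ k * 1%:~R + f%:R * alpha * 0%:~R = _);
     [apply: Qgen | ring].
have Qfa : Q (f%:R * alpha).
  by rewrite -[X in Q X](_ : f%:R ^+ k * 0%:~R + f%:R * alpha * 1%:~R = _);
     [apply: Qgen | ring].
(* For [k = 0] the generator [f ^ k] would be [1], making [Q] equal to [O]. *)
have k_gt0 : (0 < k)%N.
  rewrite lt0n; apply/eqP => k0; apply: Q_proper; apply/seteqP; split=> // x Ox.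
  by rewrite -[x]mulr1; apply: QM => //; rewrite -(expr0 (f%:R)) -k0.
have /DE[a [b alphaE]] := alphaD.
have fb : ~~ (f%:Z %| b)%Z.
  apply/negP => /dvdzP[c bE]; apply: alphaO; apply/OE; exists a, c.
  by rewrite alphaE bE; ring.
rewrite alphaE in Qfa.
have memQ := mem_lattice_congruence _ _ _ _ _ _ _ _ f_prime OE idQ NQ Qfk Qfa fb.
have NE := galNorm_quadratic _ _ _ _ w2 Kw wQ a b; rewrite -alphaE in NE.
set N := a ^+ 2 + a * b * t + b ^+ 2 * n in NE.
have f_neq0 : f%:Z != 0 by rewrite -lt0n prime_gt0.
have fkE : f%:Z ^+ k = f%:Z * f%:Z ^+ k.-1 by rewrite -exprS prednK.
have normE : dvd_norm (f%:Z ^+ k.-1) alpha <-> (f%:Z ^+ k.-1 %| N)%Z.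
  split=> [[z zN] | ]; last by exists N.
  by rewrite NE => /intr_inj_ratExt ->.
have faw : f%:R * alpha * w
  = (- (f%:Z * b * n))%:~R + (a + b * t)%:~R * (f%:R * w).
  transitivity (f%:R * (a%:~R * w + b%:~R * w ^+ 2)); first by rewrite alphaE; ring.
  by rewrite w2; ring.
have memfaw : Q (f%:R * alpha * w) <-> (f%:Z ^+ k.-1 %| N)%Z.
  rewrite faw memQ (_ : _ - _ = - (f%:Z * N)); last by rewrite /N; ring.
  by rewrite dvdzNr fkE (dvdz_mul2l f_neq0).
rewrite normE -memfaw -alphaE in Qfa *; split=> [modQ | Qfaw].
  rewrite -modQ; exists 1%N, (fun=> f%:R * alpha), (fun=> w); split=> //.
    by move=> _; apply/DE; exists 0, 1; ring.
  by rewrite big_ord1.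
have Qfkw : Q (f%:R ^+ k * w).
  have -> : f%:R ^+ k * w = 0%:~R + (f%:Z ^+ k.-1)%:~R * (f%:R * w).
    by rewrite -(prednK k_gt0) exprS rmorphXn /=; ring.
  by apply/memQ; rewrite mul0r sub0r dvdzNr dvdz_mulr // mulrC -fkE.
have Qw q : Q q -> Q (q * w).
  rewrite {1}defQ => -[x [y [Ox Oy ->]]].
  have -> : (f%:R ^+ k * x + f%:R * alpha * y) * w
    = x * (f%:R ^+ k * w) + y * (f%:R * alpha * w) by ring.
  by apply: QD; apply: QM.
apply/seteqP; split=> [_ [m [p [q [Qp Dq ->]]]] | q Qq]; last first.
  exists 1%N, (fun=> q), (fun=> 1); split=> //.
    by move=> _; apply/DE; exists 1, 0; ring.
  by rewrite big_ord1 mulr1.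
apply: (big_ind Q) => // i _.
have /DE[x [y ->]] := Dq i.
have -> : p i * (x%:~R + y%:~R * w) = x%:~R * p i + y%:~R * (p i * w) by ring.
by apply: QD; apply: QM => //; apply: Qw.
Qed.
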